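(* Let $\rho,c,\tau_q,k,\mu^2,l,\mathbf{T}>0$ be constants, let $J,N\in\mathbb{N}$, and set $\Delta x=\frac{l}{J+1}$, $\Delta t=\frac{\mathbf{T}}{N+1}$. Let $(T_j^n,q_j^n)$ be the numerical solution of the finite-difference scheme described in the context, and define, for $n=0,1,\dots,N+1$, $$\mathbf{E}^n:=\rho c\,\frac{\Delta x}{2}\sum_{j=0}^{J}|T_j^n|^2+\frac{\tau_q}{k}\frac{\Delta x}{2}\sum_{j=0}^{J}|q_j^n|^2.$$ Then, for all $\Delta x,\Delta t\in(0,1)$, the rate of change of the numerical energy $\mathbf{E}^n$ at the instant $t_n$ satisfies $$\frac{\mathbf{E}^n-\mathbf{E}^{n-1}}{\Delta t}\le-\frac1k\Delta x\sum_{j=0}^{J}|q_j^n|^2-\frac{\mu^2}{k}\Delta x\sum_{j=0}^{J}\bigg|\frac{q_{j+1}^n-q_j^n}{\Delta x}\bigg|^2<0$$ for all $n=1,2,\dots,N+1$.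
   Context: The scheme is an implicit discretization, on the mesh $x_j=j\Delta x$ ($j=0,\dots,J+1$), $t_n=n\Delta t$ ($n=0,\dots,N+1$), of the system $\rho cT_t+q_x=0$, $\tau_qq_t+q-\mu^2q_{xx}+kT_x=0$ in $(0,l)\times(0,\mathbf{T})$ with $q=0$ at $x=0,l$ and prescribed initial data for $T$ and $q$. The real unknowns $T_j^n,q_j^n$ approximate $T(x_j,t_n),q(x_j,t_n)$ and satisfy, for $n=1,\dots,N+1$, $$\rho c\,\frac{T_j^n-T_j^{n-1}}{\Delta t}+\frac{q_{j+1}^n-q_j^n}{\Delta x}=0,\qquad j=0,1,\dots,J,$$ $$\tau_q\frac{q_j^n-q_j^{n-1}}{\Delta t}+q_j^n-\mu^2\frac{q_{j+1}^n-2q_j^n+q_{j-1}^n}{\Delta x^2}+k\frac{T_j^n-T_{j-1}^n}{\Delta x}=0,\qquad j=1,\dots,J,$$ together with the boundary conditions $q_0^n=q_{J+1}^n=0$ for all $n=0,1,\dots,N+1$ and the initial conditions $T_j^0=T_{0j}$, $q_j^0=q_{0j}$ for all $j=0,1,\dots,J+1$, with given data $T_{0j},q_{0j}$.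
   Formalization: The strict inequality ''<0'' is asserted only when some q_j^n is nonzero (otherwise ''≤0''), since for zero initial data, or whenever q^n vanishes identically (always if J=0), the right-hand side equals 0. *)

(* Defs.v *)
From HB Require Import structures.
From mathcomp Require Import all_boot all_order all_algebra.
From mathcomp Require Import reals.

Set Implicit Arguments.
Unset Strict Implicit.
Unset Printing Implicit Defensive.

Import Order.TTheory GRing.Theory Num.Theory.
Local Open Scope ring_scope.

(* Grid functions are maps [u : nat -> nat -> R], where [u n j] stands for the
   value u_j^n at time t_n and node x_j.  Only the values with n <= N.+1 and
   j <= J.+1 matter: nothing is required outside the mesh. *)

Record is_numerical_solution (R : realType) (rho c tauq k mu dx dt : R)
    (J N : nat) (T0 q0 : nat -> R) (T q : nat -> nat -> R) : Prop := {
  scheme_T : forall n j, (1 <= n <= N.+1)%N -> (j <= J)%N ->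
    rho * c * ((T n j - T n.-1 j) / dt) + (q n j.+1 - q n j) / dx = 0;
  scheme_q : forall n j, (1 <= n <= N.+1)%N -> (1 <= j <= J)%N ->
    tauq * ((q n j - q n.-1 j) / dt) + q n j
      - mu ^+ 2 * ((q n j.+1 - 2 * q n j + q n j.-1) / dx ^+ 2)
      + k * ((T n j - T n j.-1) / dx) = 0;
  boundary_l : forall n, (n <= N.+1)%N -> q n 0%N = 0;
  boundary_r : forall n, (n <= N.+1)%N -> q n J.+1 = 0;
  initial_T : forall j, (j <= J.+1)%N -> T 0%N j = T0 j;
  initial_q : forall j, (j <= J.+1)%N -> q 0%N j = q0 j
}.

Definition energy (R : realType) (rho c tauq k dx : R) (J : nat)
    (T q : nat -> nat -> R) (n : nat) : R :=
  rho * c * (dx / 2) * (\sum_(0 <= j < J.+1) `|T n j| ^+ 2)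
  + tauq / k * (dx / 2) * (\sum_(0 <= j < J.+1) `|q n j| ^+ 2).

(* Main.v *)
Require Import Defs.
From HB Require Import structures.
From mathcomp Require Import all_boot all_order all_algebra.
From mathcomp Require Import reals.
From mathcomp Require Import ring.

Set Implicit Arguments.
Unset Strict Implicit.
Unset Printing Implicit Defensive.

Import Order.TTheory GRing.Theory Num.Theory.
Local Open Scope ring_scope.

(** The scheme dissipates energy because it is implicit and its two difference
quotients are adjoint to each other.  Test the first equation with
[dx * T n j] and the second with [dx / k * q n j].  Since
[a * (a - b) = (a ^+ 2 - b ^+ 2) / 2 + (a - b) ^+ 2 / 2], the implicit time
differences produce the increment of the energy plus nonnegative squares, and
discarding these squares is the only source of the inequality.

What remains is summation by parts in space.  It is done here cell by cell: the
coupling and diffusion terms of cell [j], once the claimed dissipation has been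
added, are exactly the difference [flux j.+1 - flux j] of a quantity that
carries [q n j] as a factor ([cell_energy_dissipation]).  Summed over the
mesh these differences telescope, and the boundary conditions kill both ends.

The dissipation vanishes only when every [q n j] with [j <= J] does, and the
remaining node [J.+1] is a boundary node; this gives the strict sign. *)

(** Energy balance in one cell, where [tl] and [ql], [qr] are the values at the
left and right neighbours and [t0], [q0] those at the previous time.  The heat
flux equation is only assumed after multiplication by [q], which makes the
lemma available at the left boundary, where that equation is not part of the
scheme but [q = 0]. *)
Lemma cell_energy_dissipation (R : realFieldType)
    (rc tauq k m dx dt t t0 tl q q0 ql qr : R) :
  0 < rc -> 0 < tauq -> 0 < k -> 0 < dx -> 0 < dt ->
  rc * ((t - t0) / dt) + (qr - q) / dx = 0 ->
  q * (tauq * ((q - q0) / dt) + q - m * ((qr - 2 * q + ql) / dx ^+ 2)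
       + k * ((t - tl) / dx)) = 0 ->
  (rc * (dx / 2) * (t ^+ 2 - t0 ^+ 2)
   + tauq / k * (dx / 2) * (q ^+ 2 - q0 ^+ 2)) / dt
  + (1 / k * dx * q ^+ 2 + m / k * dx * ((qr - q) / dx) ^+ 2)
  <= qr * (m / (k * dx) * (qr - q) - t) - q * (m / (k * dx) * (q - ql) - tl).
Proof.
move=> rc0 tau0 k0 dx0 dt0 eqT eqq.
pose sq := rc * (dx / (2 * dt)) * (t - t0) ^+ 2
           + tauq / k * (dx / (2 * dt)) * (q - q0) ^+ 2.
have sq_ge0 : 0 <= sq.
  have h2 : 0 <= dx / (2 * dt) by rewrite divr_ge0 ?mulr_ge0 // ltW.
  have htk : 0 <= tauq / k by rewrite divr_ge0 // ltW.
  by rewrite addr_ge0 // mulr_ge0 ?sqr_ge0 // mulr_ge0 // ltW.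
(* the slack in the inequality is [sq], up to the two tested equations *)
move/(congr1 ( *%R (dx * t))): eqT; move/(congr1 ( *%R (dx / k))): eqq.
rewrite !mulr0 => eqq eqT; rewrite -subr_ge0.
rewrite -[leRHS]addr0 -[X in _ <= _ + X]eqT.
rewrite -[leRHS]addr0 -[X in _ <= _ + X]eqq.
by rewrite [leRHS](_ : _ = sq) // /sq; field; rewrite !gt_eqF.
Qed.

Lemma sum_sqr_gt0 (R : realDomainType) (u : nat -> R) (m j : nat) :
  (j < m)%N -> u j != 0 -> 0 < \sum_(0 <= i < m) `|u i| ^+ 2.
Proof.
move=> jm uj0; rewrite big_mkord (bigD1 (Ordinal jm)) //=.
rewrite ltr_pwDl ?exprn_gt0 ?normr_gt0 // sumr_ge0 // => i _.
exact: exprn_ge0.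
Qed.

(* The strict sign of the dissipation fails when q^n vanishes identically (for
   instance for zero data), so it is asserted when q^n is not identically zero;
   the non-strict sign is asserted always. *)
Theorem theorem5p1 (R : realType) (rho c tauq k mu l Tf : R) (J N : nat)
    (T0 q0 : nat -> R) (T q : nat -> nat -> R)
    (hrho : 0 < rho) (hc : 0 < c) (htauq : 0 < tauq) (hk : 0 < k)
    (hmu : 0 < mu ^+ 2) (hl : 0 < l) (hTf : 0 < Tf) :
  let dx := l / J.+1%:R in
  let dt := Tf / N.+1%:R in
  let E := energy rho c tauq k dx J T q in
  0 < dx < 1 -> 0 < dt < 1 ->
  is_numerical_solution rho c tauq k mu dx dt J N T0 q0 T q ->
  forall n, (1 <= n <= N.+1)%N ->
  let D := - (1 / k * dx * (\sum_(0 <= j < J.+1) `|q n j| ^+ 2))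
           - mu ^+ 2 / k * dx *
             (\sum_(0 <= j < J.+1) `|(q n j.+1 - q n j) / dx| ^+ 2) in
  [/\ (E n - E n.-1) / dt <= D,
      D <= 0 &
      (exists2 j, (j <= J.+1)%N & q n j != 0) -> D < 0].
Proof.
move=> dx dt E /andP[dx0 _] /andP[dt0 _] [eqT eqq bl br _ _] n hn D.
have nN : (n <= N.+1)%N by case/andP: hn.
have sum_ge0 (u : nat -> R) : 0 <= \sum_(0 <= j < J.+1) `|u j| ^+ 2.
  by apply: sumr_ge0 => j _; rewrite exprn_ge0.
have a0 : 0 < 1 / k * dx by rewrite mulr_gt0 // divr_gt0.
have b0 : 0 < mu ^+ 2 / k * dx by rewrite mulr_gt0 // divr_gt0.
split.
- (* at [j = 0] the left neighbour [0.-1] is [0] itself, which is harmless as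
     its values only enter multiplied by [q n 0 = 0] *)
  pose flux j := q n j * (mu ^+ 2 / (k * dx) * (q n j - q n j.-1) - T n j.-1).
  have telescoped : \sum_(0 <= j < J.+1) (flux j.+1 - flux j) = 0.
    by rewrite telescope_sumr // /flux br // bl // !mul0r subrr.
  have cell_sum : (E n - E n.-1) / dt - D =
    \sum_(0 <= j < J.+1)
      ((rho * c * (dx / 2) * (T n j ^+ 2 - T n.-1 j ^+ 2)
        + tauq / k * (dx / 2) * (q n j ^+ 2 - q n.-1 j ^+ 2)) / dt
       + (1 / k * dx * q n j ^+ 2
          + mu ^+ 2 / k * dx * ((q n j.+1 - q n j) / dx) ^+ 2)).
    rewrite /E /energy /D -opprD opprK.
    have sqr_normE (u : nat -> R) :
        \sum_(0 <= j < J.+1) `|u j| ^+ 2 = \sum_(0 <= j < J.+1) u j ^+ 2.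
      by apply: eq_bigr => j _; rewrite real_normK ?num_real.
    rewrite !sqr_normE !big_split -mulr_suml big_split -!mulr_sumr !sumrB /=.
    by congr (_ / _ + _); ring.
  rewrite -subr_le0 cell_sum -[leRHS]telescoped.
  apply: ler_sum_nat => j /= jJ.
  rewrite /flux /=; apply: cell_energy_dissipation => //; first exact: mulr_gt0.
    exact: eqT.
  by case: j jJ => [|j] jJ; [rewrite bl // mul0r | rewrite eqq ?mulr0].
- by rewrite /D -opprD oppr_le0 addr_ge0 // mulr_ge0 // ltW.
- case=> j; rewrite leq_eqVlt => /predU1P[->|jJ] qj0.
    by rewrite br ?eqxx in qj0.
  have sum_gt0 := sum_sqr_gt0 jJ qj0.
  rewrite /D -opprD oppr_lt0; apply: ltr_pwDl; first exact: mulr_gt0.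
  by rewrite mulr_ge0 // ltW.
Qed.
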